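(* For a complete first-order theory $T$, the following are equivalent: (1) $T$ is supersimple; (2) there do not exist a finite tuple $d$ and an increasing sequence of sets $\langle A_i\mid i<\omega\rangle$ such that $\mathrm{tp}(d/A_{i+1})$ Kim-forks over $A_i$ for each $i<\omega$; (3) there do not exist a finite tuple $d$ and an increasing sequence of countable sets $\langle A_i\mid i<\omega\rangle$ such that $\mathrm{tp}(d/A_{i+1})$ Kim-forks over $A_i$ for each $i<\omega$.
   Context: We work in a monster model of $T$. A formula $\varphi(x,a_0)$ divides over $A$ if there is an $A$-indiscernible sequence $\langle a_i\mid i<\omega\rangle$ with $\{\varphi(x,a_i)\}$ inconsistent; it forks over $A$ if it implies a finite disjunction of formulas each dividing over $A$; $a\mathop{\smile\!\!\!\!\!\!\;|}_AB$ means $\mathrm{tp}(a/AB)$ implies no formula forking over $A$. $T$ is supersimple if for every finite tuple $a$ and every set $A$ there is a finite $A_0\subseteq A$ with $a\mathop{\smile\!\!\!\!\!\!\;|}_{A_0}A$. A Morley sequence over $A$ is an $A$-indiscernible sequence $\langle a_i\mid i<\omega\rangle$ with $a_i\mathop{\smile\!\!\!\!\!\!\;|}_A a_{<i}$. A formula $\varphi(x,a_0)$ Kim-divides over $A$ if $\{\varphi(x,a_i)\mid i<\omega\}$ is inconsistent for some Morley sequence $\langle a_i\mid i<\omega\rangle$ over $A$; it Kim-forks over $A$ if it implies a finite disjunction of formulas each Kim-dividing over $A$; a type Kim-forks over $A$ if it implies a formula that Kim-forks over $A$. *)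

(* Defs.v *)
From mathcomp Require Import all_boot.
From mathcomp Require Import boolp classical_sets functions cardinality.

Set Implicit Arguments.
Unset Strict Implicit.
Unset Printing Implicit Defensive.

Local Open Scope classical_set_scope.
Local Open Scope card_scope.

Record language : Type := Language {
  func : Type;
  func_arity : func -> nat;
  rel : Type;
  rel_arity : rel -> nat
}.

Inductive term (L : language) (V : Type) : Type :=
| Var of V
| App (f : func L) of ('I_(func_arity f) -> term L V).

(* [formula L V] is the type of formulas with free variables in [V]; the
   variable bound by [All] is [None].  Sentences are the elements of
   [formula L void]. *)
Inductive formula (L : language) (V : Type) : Type :=
| Bot
| Eql of term L V & term L V
| Rel (r : rel L) of ('I_(rel_arity r) -> term L V)
| Imp of formula L V & formula L V
| All of formula L (option V).

Arguments Bot {L V}.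

Record structure (L : language) : Type := Structure {
  carrier :> Type;
  carrier_inhabited : inhabited carrier;
  func_interp : forall f : func L, ('I_(func_arity f) -> carrier) -> carrier;
  rel_interp : forall r : rel L, ('I_(rel_arity r) -> carrier) -> Prop
}.

Fixpoint eval (L : language) (M : structure L) (V : Type) (v : V -> M)
    (t : term L V) : M :=
  match t with
  | Var x => v x
  | App f ts => func_interp (fun i => eval v (ts i))
  end.

Fixpoint sat (L : language) (M : structure L) (V : Type) (phi : formula L V) :
    (V -> M) -> Prop :=
  match phi with
  | Bot => fun _ => False
  | Eql t u => fun v => eval v t = eval v u
  | Rel r ts => fun v => rel_interp (fun i => eval v (ts i))
  | Imp phi psi => fun v => sat phi v -> sat psi v
  | All phi => fun v => forall a : M, sat phi (oapp v a)
  end.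

Definition sentence (L : language) : Type := formula L void.

Definition holds (L : language) (M : structure L) (sigma : sentence L) : Prop :=
  sat sigma (of_void M).

Definition theory (L : language) : Type := set (sentence L).

Definition models (L : language) (M : structure L) (T : theory L) : Prop :=
  T `<=` holds M.

Definition complete_theory (L : language) (T : theory L) : Prop :=
  (exists M : structure L, models M T) /\
  forall sigma : sentence L,
    (forall M : structure L, models M T -> holds M sigma) \/
    (forall M : structure L, models M T -> ~ holds M sigma).

(* A formula [phi(x, a)], where [x] is a tuple of variables indexed by [X] and
   [a] is a finite tuple of parameters in [M]. *)
Record pformula (L : language) (M : structure L) (X : Type) : Type := PFormula {
  nparams : nat;
  matrix : formula L (X + 'I_nparams);
  params : 'I_nparams -> M
}.

Arguments PFormula {L M X nparams} _ _.
Arguments params {L M X} _ _.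

Definition join (X Y Z : Type) (x : X -> Z) (y : Y -> Z) (u : X + Y) : Z :=
  match u with inl i => x i | inr j => y j end.

Definition psat (L : language) (M : structure L) (X : Type)
    (phi : pformula M X) (x : X -> M) : Prop :=
  sat (matrix phi) (join x (params phi)).

Definition over (L : language) (M : structure L) (X : Type) (A : set M) :
    set (pformula M X) :=
  [set phi | range (params phi) `<=` A].

Definition tp (L : language) (M : structure L) (X : Type) (a : X -> M)
    (A : set M) : set (pformula M X) :=
  [set phi | over A phi /\ psat phi a].

Definition realizes (L : language) (M : structure L) (X : Type)
    (p : set (pformula M X)) (x : X -> M) : Prop :=
  forall phi, p phi -> psat phi x.

Definition consistent (L : language) (M : structure L) (X : Type)
    (p : set (pformula M X)) : Prop :=
  exists x : X -> M, realizes p x.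

(* As usual in a monster model, consistency and implication are tested on
   realizations in [M].  By saturation this is the same as consistency and
   implication in all elementary extensions of [M], for sets of formulas over a
   small set of parameters (the only ones to which they are applied below). *)
Definition implies (L : language) (M : structure L) (X : Type)
    (p : set (pformula M X)) (phi : pformula M X) : Prop :=
  forall x : X -> M, realizes p x -> psat phi x.

Definition implies_disj (L : language) (M : structure L) (X : Type)
    (phi : pformula M X) (Psi : set (pformula M X)) : Prop :=
  forall x : X -> M, psat phi x -> exists2 psi, Psi psi & psat psi x.

Definition card_lt (T U : Type) (A : set T) (B : set U) : Prop :=
  A #<= B /\ ~ (B #<= A).

(* Cardinals are represented by types: below, [kappa] is the cardinality of the
   type [K]. *)
Definition small (K T : Type) (A : set T) : Prop := card_lt A [set: K].

Definition saturated (K : Type) (L : language) (M : structure L) : Prop :=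
  forall (n : nat) (A : set M) (p : set (pformula M 'I_n)),
    small K A -> p `<=` over A ->
    (forall q, q `<=` p -> finite_set q -> consistent q) ->
    consistent p.

Definition automorphism (L : language) (M : structure L) (g : M -> M) : Prop :=
  [/\ bijective g,
      (forall (f : func L) (a : 'I_(func_arity f) -> M),
          g (func_interp a) = func_interp (g \o a)) &
      (forall (r : rel L) (a : 'I_(rel_arity r) -> M),
          rel_interp a <-> rel_interp (g \o a))].

(* The restriction of [f] to [A] is a partial elementary map. *)
Definition elementary_on (L : language) (M : structure L) (A : set M)
    (f : M -> M) : Prop :=
  forall (n : nat) (a : 'I_n -> M) (phi : formula L 'I_n),
    range a `<=` A -> (sat phi a <-> sat phi (f \o a)).

Definition strongly_homogeneous (K : Type) (L : language) (M : structure L) :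
    Prop :=
  forall (A : set M) (f : M -> M), small K A -> elementary_on A f ->
    exists2 g : M -> M, automorphism g & (forall x, A x -> g x = f x).

(* [M] is a [kappa]-saturated and strongly [kappa]-homogeneous model of [T] for
   some [kappa > |L| + aleph_0]; small means of cardinality [< kappa]. *)
Record monster_model (L : language) (T : theory L) (K : Type)
    (M : structure L) : Prop := MonsterModel {
  monster_models : models M T;
  monster_uncountable : small K [set: nat];
  monster_func : small K [set: func L];
  monster_rel : small K [set: rel L];
  monster_saturated : saturated K M;
  monster_homogeneous : strongly_homogeneous K M
}.

Definition indiscernible (L : language) (M : structure L) (m : nat) (A : set M)
    (s : nat -> 'I_m -> M) : Prop :=
  forall (k : nat) (i j : 'I_k -> nat),
    {homo i : x y / (x < y)%N} -> {homo j : x y / (x < y)%N} ->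
    tp (fun u : 'I_k * 'I_m => s (i u.1) u.2) A =
    tp (fun u : 'I_k * 'I_m => s (j u.1) u.2) A.

Definition instances (L : language) (M : structure L) (X : Type) (m : nat)
    (phi : formula L (X + 'I_m)) (s : nat -> 'I_m -> M) : set (pformula M X) :=
  range (fun i => PFormula phi (s i)).

Definition divides (L : language) (M : structure L) (X : Type) (A : set M) :
    set (pformula M X) :=
  [set phi | exists s : nat -> 'I_(nparams phi) -> M,
     [/\ s 0 = params phi, indiscernible A s &
         ~ consistent (instances (matrix phi) s)]].

Definition forks (L : language) (M : structure L) (X : Type) (A : set M) :
    set (pformula M X) :=
  [set phi | exists Psi : set (pformula M X),
     [/\ finite_set Psi, Psi `<=` divides A & implies_disj phi Psi]].

Definition independent (L : language) (M : structure L) (X : Type)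
    (A : set M) (a : X -> M) (B : set M) : Prop :=
  forall phi, implies (tp a (A `|` B)) phi -> ~ forks A phi.

Definition supersimple (K : Type) (L : language) (M : structure L) : Prop :=
  forall (n : nat) (a : 'I_n -> M) (A : set M), small K A ->
    exists A0 : set M, [/\ A0 `<=` A, finite_set A0 & independent A0 a A].

Definition morley (L : language) (M : structure L) (m : nat) (A : set M)
    (s : nat -> 'I_m -> M) : Prop :=
  indiscernible A s /\
  forall i : nat, independent A (s i) (\bigcup_(j in `I_i) range (s j)).

Definition kim_divides (L : language) (M : structure L) (X : Type)
    (A : set M) : set (pformula M X) :=
  [set phi | exists s : nat -> 'I_(nparams phi) -> M,
     [/\ s 0 = params phi, morley A s &
         ~ consistent (instances (matrix phi) s)]].

Definition kim_forks (L : language) (M : structure L) (X : Type) (A : set M) :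
    set (pformula M X) :=
  [set phi | exists Psi : set (pformula M X),
     [/\ finite_set Psi, Psi `<=` kim_divides A & implies_disj phi Psi]].

Definition type_kim_forks (L : language) (M : structure L) (X : Type)
    (A : set M) (p : set (pformula M X)) : Prop :=
  exists2 phi, implies p phi & kim_forks A phi.

(* Main.v *)
(* (1) => (2): only finitely many parameters of each tp(d/A_{i+1}) are needed to
   imply the forking formula, and forking over A_i persists over subsets of A_i;
   so a Kim-forking chain yields a countable A' such that tp(d/A') forks over
   every finite subset of A'.

   (3) => (1): order the formulas by letting [phi /\ chi] be a child of [phi] when
   it is consistent and [chi] divides over the parameters of [phi].  If [chi]
   divides over A, as witnessed by the sequence [s], then the average of [s] along
   a nonprincipal ultrafilter over A, [s] is finitely satisfiable in [s], hence
   generates a Morley sequence, so that up to an automorphism [chi] Kim-divides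
   over A, [s].  An infinite branch of children therefore yields a chain
   forbidden by (3), and the order is well founded.  On the other hand, if tp(a/A)
   forks over every finite subset of A, then a finite cover of tp(a/A) by formulas
   can be replaced by one by children of automorphic copies of these formulas; by
   well-founded induction the cover becomes empty, which is absurd. *)

Require Import Defs.
From mathcomp Require Import all_boot.
From mathcomp Require Import boolp classical_sets functions cardinality filter.

Set Implicit Arguments.
Unset Strict Implicit.
Unset Printing Implicit Defensive.

Local Open Scope classical_set_scope.
Local Open Scope card_scope.

(** * Finite sets, filters and ultrafilters *)

Lemma finite_set_induction (T : Type) (P : set T -> Prop) :
  P set0 -> (forall x A, P A -> P (x |` A)) -> forall A, finite_set A -> P A.
Proof.
move=> P0 PU A; rewrite (@finite_seqP {classic T}) => -[s ->].
elim: s => [|x s IHs]; first by rewrite set_nil.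
rewrite (_ : [set` x :: s] = x |` [set` s]); first exact: PU.
by apply/predeqP => y /=; rewrite inE; split=> [/orP[/eqP|]|[->|->]];
  rewrite ?eqxx ?orbT; [left|right| |].
Qed.

Lemma filter_finite_forall (I T : Type) (F : set_system T) (J : set I)
    (P : I -> set T) : Filter F -> finite_set J ->
  (forall i, J i -> F (P i)) -> F [set t | forall i, J i -> P i t].
Proof.
move=> FF finJ; elim/finite_set_induction: finJ => [_|i A IHA FP].
  by apply: filterS filterT => t _ i [].
have FA : F [set t | forall i, A i -> P i t] by apply: IHA => j Aj; apply: FP; right.
by apply: filterS2 (FP i (or_introl erefl)) FA => t Pit PA j [->|/PA].
Qed.

Lemma ultra_setC (T : Type) (U : set_system T) (A : set T) :
  UltraFilter U -> U (~` A) <-> ~ U A.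
Proof.
move=> UU; split=> [UnA UA|nUA]; last by case: (in_ultra_setVsetC A UU).
by apply: (@filter_not_empty _ U _); rewrite -(setICr A); apply: filterI.
Qed.

Lemma ultra_ext (T : Type) (U : set_system T) (A B : set T) :
  Filter U -> (forall t, A t <-> B t) -> U A <-> U B.
Proof. by move=> FU /predeqP ->. Qed.

(** * Cardinalities *)

(** As in Hilbert's hotel, a sequence [h] of distinct elements of [A] makes room for [C]: [h (2n)]
    goes to [h n], [h (2n+1)] to the [n]-th element [c n] of [C], and everything else is fixed. *)
Lemma infinite_countableU_card_le (T : Type) (A C : set T) :
  infinite_set A -> countable C -> A `|` C #<= A.
Proof.
elim/Ppointed: T => T in A C *; first by rewrite !emptyE.
move=> /infiniteP/pcard_leP[h]; case/pfcard_geP => [->|[c]]; first by rewrite setU0.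
have hinj : injective h by move=> i j; apply: 'inj_h; rewrite inE.
have fP x : exists y, (forall n, x = h n.*2 -> y = h n) /\
    (forall n, x = h n.*2.+1 -> y = c n) /\ ((forall n, x <> h n) -> y = x).
  case: (pselect (exists n, x = h n)) => [[n ->]|nx]; last first.
    by exists x; split=> [n xn|]; [|split=> // n xn]; case: nx; eexists; exact: xn.
  exists (if odd n then c n./2 else h n./2).
  split=> [m /hinj ->|]; first by rewrite odd_double half_double.
  by split=> [m /hinj ->|/(_ n)//]; rewrite /= odd_double uphalf_double.
have [f fP'] := choice fP.
apply: card_le_trans (card_image_le f A); apply: subset_card_le.
move=> x [Ax|Cx].
  case: (pselect (exists n, x = h n)) => [[n ->]|nx].
    exists (h n.*2); first exact: 'funS_h.
    by rewrite (proj1 (fP' _) n).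
  exists x => //; rewrite (proj2 (proj2 (fP' _)))// => n xn; apply: nx.
  by exists n.
have [n _ <-] := 'surj_c Cx.
exists (h n.*2.+1); first exact: 'funS_h.
by rewrite (proj1 (proj2 (fP' _)) n).
Qed.

Lemma countableU (T : Type) (A B : set T) :
  countable A -> countable B -> countable (A `|` B).
Proof.
move=> cA cB; rewrite -bigcup2E; apply: bigcup_countable => //.
by case=> [|[|i]] _ /=.
Qed.

Section Small.
Variables (K : Type) (K_uncountable : small K [set: nat]).

Lemma countable_small (T : Type) (A : set T) : countable A -> small K A.
Proof.
case: K_uncountable => leK nleK cA; split; first exact: card_le_trans leK.
by move=> KA; apply: nleK; apply: card_le_trans cA.
Qed.

Lemma smallU_countable (T : Type) (A C : set T) :
  small K A -> countable C -> small K (A `|` C).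
Proof.
move=> [AK KA] cC; case: (pselect (finite_set A)) => [finA|infA].
  by apply/countable_small/countableU => //; exact: finite_set_countable.
have leA := infinite_countableU_card_le infA cC.
by split=> [|KAC]; [exact: card_le_trans AK | apply: KA; exact: card_le_trans leA].
Qed.

End Small.

(** * Renaming of variables and automorphisms *)

Fixpoint term_map (L : language) (V W : Type) (f : V -> W) (t : term L V) :
    term L W :=
  match t with
  | Var x => Var L (f x)
  | App g ts => App (fun i => term_map f (ts i))
  end.

Fixpoint formula_map (L : language) (V W : Type) (f : V -> W)
    (phi : formula L V) : formula L W :=
  match phi with
  | Bot => Bot
  | Eql t u => Eql (term_map f t) (term_map f u)
  | Rel r ts => Rel (fun i => term_map f (ts i))
  | Imp phi psi => Imp (formula_map f phi) (formula_map f psi)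
  | All phi => All (formula_map (omap f) phi)
  end.

Section Structure.
Variables (L : language) (M : structure L).

Lemma eval_map (V W : Type) (f : V -> W) (t : term L V) (w : W -> M) :
  eval w (term_map f t) = eval (w \o f) t.
Proof. by elim: t => //= g ts IH; congr func_interp; apply/funext. Qed.

Lemma sat_map (V W : Type) (f : V -> W) (phi : formula L V) (w : W -> M) :
  sat (formula_map f phi) w <-> sat phi (w \o f).
Proof.
elim: phi W f w => {V} [V|V t u|V r ts|V p IHp q IHq|V p IHp] W f w //=.
- by rewrite !eval_map.
- by under eq_fun do rewrite eval_map.
- by rewrite IHp IHq.
- split=> H a; move: (H a); rewrite IHp;
    by congr sat; apply/funext => -[].
Qed.

Lemma eval_automorphism (g : M -> M) (V : Type) (t : term L V) (v : V -> M) :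
  automorphism g -> eval (g \o v) t = g (eval v t).
Proof.
case=> _ gf _; elim: t => //= f ts IH.
by rewrite gf; congr func_interp; apply/funext.
Qed.

Lemma sat_automorphism (g : M -> M) (V : Type) (phi : formula L V)
    (v : V -> M) : automorphism g -> sat phi (g \o v) <-> sat phi v.
Proof.
move=> gA; have [[h hK gK] gf gr] := gA.
elim: phi v => {V} [V|V t u|V r ts|V p IHp q IHq|V p IHp] v //=.
- by rewrite !eval_automorphism//; split=> [/(can_inj hK)|->].
- rewrite (gr r (fun i => eval v (ts i))).
  by under eq_fun do rewrite eval_automorphism//.
- by rewrite IHp IHq.
- split=> H a; last rewrite -(gK a).
    move: (H (g a)); rewrite -(IHp (oapp v a)).
    by congr sat; apply/funext => -[].
  move: (H (h a)); rewrite -(IHp (oapp v (h a))).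
  by congr sat; apply/funext => -[].
Qed.

Lemma automorphism_comp (g h : M -> M) :
  automorphism g -> automorphism h -> automorphism (g \o h).
Proof.
move=> [gb gf gr] [hb hf hr]; split; first exact: bij_comp.
  by move=> f a; rewrite /= hf gf.
by move=> r a; rewrite hr gr.
Qed.

Lemma automorphism_id : automorphism (@id M).
Proof. by split=> //; exists id. Qed.

Lemma automorphism_inv (g : M -> M) : automorphism g ->
  exists h, [/\ automorphism h, cancel g h & cancel h g].
Proof.
move=> [[h hK gK] gf gr]; exists h; split=> //; split; first by exists g.
  move=> f a; apply: (can_inj hK); rewrite gf gK; congr func_interp.
  by apply/funext => i /=; rewrite gK.
move=> r a; rewrite (gr r (h \o a)).
by rewrite (_ : g \o (h \o a) = a)//; apply/funext => i /=; rewrite gK.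
Qed.

(** * Formulas with parameters *)

Definition pneg (X : Type) (phi : pformula M X) : pformula M X :=
  PFormula (Imp (matrix phi) Bot) (params phi).

Lemma pnegE (X : Type) (phi : pformula M X) x : psat (pneg phi) x <-> ~ psat phi x.
Proof. by []. Qed.

Definition ptop (X : Type) : pformula M X :=
  @PFormula _ _ _ 0 (Imp Bot Bot) (fun i => match notF (ltn_ord i) with end).

Lemma split_lshift (m n : nat) (i : 'I_m) : fintype.split (lshift n i) = inl i.
Proof. exact: (unsplitK (inl i)). Qed.

Lemma split_rshift (m n : nat) (i : 'I_n) : fintype.split (rshift m i) = inr i.
Proof. exact: (unsplitK (inr i)). Qed.

Definition pand (X : Type) (phi psi : pformula M X) : pformula M X :=
  let f u := match u with inl x => inl x | inr i => inr (lshift _ i) end in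
  let g u := match u with inl x => inl x | inr i => inr (rshift _ i) end in
  PFormula (Imp (Imp (formula_map f (matrix phi))
                     (Imp (formula_map g (matrix psi)) Bot)) Bot)
    (fun i => match fintype.split i with
              | inl j => params phi j
              | inr j => params psi j
              end).

Lemma pandE (X : Type) (phi psi : pformula M X) x :
  psat (pand phi psi) x <-> psat phi x /\ psat psi x.
Proof.
rewrite /psat /= !sat_map.
set v := _ \o _; set w := _ \o _.
have -> : v = join x (params phi).
  by apply/funext => -[y|i] //; rewrite /v /= split_lshift.
have -> : w = join x (params psi).
  by apply/funext => -[y|i] //; rewrite /w /= split_rshift.
split=> [|[? ?]]; last exact.
by move=> H; apply: contrapT => nH; apply: H => p q; apply: nH.
Qed.

Lemma params_pandr (X : Type) (phi psi : pformula M X) :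
  range (params psi) `<=` range (params (pand phi psi)).
Proof. by move=> _ [i _ <-]; exists (rshift _ i) => //=; rewrite split_rshift. Qed.

Definition pact (X : Type) (g : M -> M) (phi : pformula M X) : pformula M X :=
  PFormula (matrix phi) (g \o params phi).

Lemma psat_pact (X : Type) (g : M -> M) (phi : pformula M X) x :
  automorphism g -> psat (pact g phi) (g \o x) <-> psat phi x.
Proof.
move=> gA; rewrite /psat /=.
have -> : join (g \o x) (g \o params phi) = g \o join x (params phi).
  by apply/funext => -[].
exact: sat_automorphism.
Qed.

Lemma pact_pand (X : Type) (g : M -> M) (phi psi : pformula M X) :
  pact g (pand phi psi) = pand (pact g phi) (pact g psi).
Proof.
rewrite /pact /pand /=; congr PFormula; apply/funext => i /=.
by case: fintype.split.
Qed.

Lemma pact_id (X : Type) (g : M -> M) (phi : pformula M X) :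
  (forall c, range (params phi) c -> g c = c) -> pact g phi = phi.
Proof.
case: phi => n phi c gc; rewrite /pact /=; congr PFormula.
by apply/funext => i /=; apply: gc; exists i.
Qed.

Lemma pactK (X : Type) (g h : M -> M) (phi : pformula M X) :
  cancel g h -> pact h (pact g phi) = phi.
Proof. by move=> gK; apply: (@pact_id _ (h \o g) phi) => c _; exact: gK. Qed.

Lemma pact_fix (X : Type) (A : set M) (g : M -> M) (phi : pformula M X) :
  Defs.over A phi -> (forall c, A c -> g c = c) -> pact g phi = phi.
Proof. by move=> phiA gA; apply: pact_id => c /phiA; exact: gA. Qed.

Lemma eq_tpP (X : Type) (a b : X -> M) (A : set M) :
  tp a A = tp b A <-> forall phi, Defs.over A phi -> psat phi a <-> psat phi b.
Proof.
split=> [/predeqP eqt phi phiA|eqt].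
  by have [H1 H2] := eqt phi; split=> s; [case: H1|case: H2].
by apply/predeqP => phi; split=> -[phiA s]; split=> //; apply/(eqt phi phiA).
Qed.

Lemma over_sub (X : Type) (A B : set M) (phi : pformula M X) :
  A `<=` B -> Defs.over A phi -> Defs.over B phi.
Proof. by move=> AB phiA; apply: subset_trans AB. Qed.

(* A formula whose variables are replaced by variables from [Y] or by
   parameters.  If some element is substituted, it also serves as a dummy
   value of the parameters that are not used. *)
Lemma substitution (X : finType) (Y : Type) (phi : formula L X)
    (h : X -> Y + M) (D : set M) : (forall x c, h x = inr c -> D c) ->
  exists2 psi : pformula M Y, Defs.over D psi &
    forall y, psat psi y <-> sat phi (fun x => join y id (h x)).
Proof.
move=> hD; case: (pselect (exists c, D c)) => [[c0 Dc0]|D0].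
  exists (@PFormula L M Y #|X|
    (formula_map (fun x => match h x with inl y => inl y
                           | inr _ => inr (enum_rank x) end) phi)
    (fun i => match h (enum_val i) with inl _ => c0 | inr c => c end)).
    by move=> _ [i _ <-] /=; case E: (h (enum_val i)) => [y|c] //; exact: (hD _ _ E).
  move=> y; rewrite /psat sat_map /=.
  rewrite (_ : _ \o _ = fun x => join y id (h x))//.
  by apply/funext => x /=; case E: (h x) => //=; rewrite enum_rankK E.
have hl x : exists y, h x = inl y.
  by case E: (h x) => [y|c]; [exists y | case: D0; exists c; exact: (hD _ _ E)].
case: (choice hl) => f hf.
exists (@PFormula L M Y 0 (formula_map (inl \o f) phi)
          (fun i => match notF (ltn_ord i) with end)) => [_ [[]]//|y].
rewrite /psat sat_map /=; rewrite (_ : _ \o _ = fun x => join y id (h x))//.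
by apply/funext => x /=; rewrite hf.
Qed.

(** Passes from partial maps on sets to tuples with any index type: the equality formulas make
    [a x |-> b x] well defined on the range of [a]. *)
Lemma homogeneity (K : Type) (X : Type) (a b : X -> M) :
  strongly_homogeneous K M -> small K (range a) ->
  (forall phi : formula L X, sat phi a <-> sat phi b) ->
  exists2 g, automorphism g & forall x, g (a x) = b x.
Proof.
move=> SH sm eqab.
have wd x y : a x = a y -> b x = b y.
  by have [+ _] := eqab (Eql (Var L x) (Var L y)).
have fP c : exists d, forall x, a x = c -> d = b x.
  case: (pselect (exists x, a x = c)) => [[x ax]|nx]; last first.
    by exists c => x ax; case: nx; exists x.
  by exists (b x) => y ay; apply: wd; rewrite ax.
case: (choice fP) => f fab.
have [n c phi cA|g gA gf] := SH (range a) f sm.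
  have iP i : exists x, a x = c i by case: (cA (c i)) => [|x _ <-]; [exists i|exists x].
  case: (choice iP) => iota ac.
  have -> : c = a \o iota by apply/funext => i /=; rewrite ac.
  have -> : f \o (a \o iota) = b \o iota.
    by apply/funext => i /=; apply: fab.
  by rewrite -(sat_map iota phi a) -(sat_map iota phi b); apply: eqab.
by exists g => // x; rewrite gf ?(fab (a x) x)//; exists x.
Qed.

Lemma indiscernible_sub (m : nat) (A B : set M) (s : nat -> 'I_m -> M) :
  A `<=` B -> indiscernible B s -> indiscernible A s.
Proof.
move=> AB sB k i j hi hj; apply/eq_tpP => phi phiA.
by have /eq_tpP := sB k i j hi hj; apply; exact: over_sub phiA.
Qed.

Lemma divides_sub (X : Type) (A B : set M) :
  A `<=` B -> @divides L M X B `<=` divides A.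
Proof.
move=> AB phi [s [s0 sB ns]]; exists s; split=> //.
exact: indiscernible_sub AB sB.
Qed.

Lemma forks_sub (X : Type) (A B : set M) :
  A `<=` B -> @forks L M X B `<=` forks A.
Proof.
move=> AB phi [Psi [fin sub imp]]; exists Psi; split=> //.
by apply: subset_trans sub _; apply: divides_sub.
Qed.

Lemma kim_divides_divides (X : Type) (A : set M) :
  @kim_divides L M X A `<=` divides A.
Proof. by move=> phi [s [s0 [sA _] ns]]; exists s. Qed.

Lemma divides_pact (X : Type) (A : set M) (g : M -> M) (phi : pformula M X) :
  automorphism g -> divides A phi -> divides (g @` A) (pact g phi).
Proof.
move=> gA; have [h [hA hK gK]] := automorphism_inv gA.
move=> [s [s0 sA ns]]; exists (fun i => g \o s i); split.
- by rewrite s0.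
- move=> k i j hi hj; apply/eq_tpP => psi psiA.
  rewrite -(pactK psi gK).
  rewrite (psat_pact (pact h psi) (fun u => s (i u.1) u.2) gA).
  rewrite (psat_pact (pact h psi) (fun u => s (j u.1) u.2) gA).
  have /eq_tpP := sA k i j hi hj; apply.
  move=> _ [l _ <-] /=; case: (psiA (params psi l)) => [|c Ac <-]; first by exists l.
  by rewrite hK.
- apply: contra_not ns => -[x xR]; exists (h \o x) => _ [i _ <-].
  rewrite -(psat_pact _ _ gA).
  rewrite (_ : g \o (h \o x) = x); last by apply/funext => y /=.
  by apply: xR; exists i.
Qed.

End Structure.

Lemma countable_range (I : countType) (T : Type) (f : I -> T) :
  countable (range f).
Proof. exact: card_le_trans (card_image_le f setT) (countableP _). Qed.

(** * Averages of sequences along ultrafilters *)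

Section Monster.
Variables (K : Type) (L : language) (M : structure L).
Hypothesis K_uncountable : small K [set: nat].
Hypothesis M_saturated : saturated K M.
Hypothesis M_homogeneous : strongly_homogeneous K M.

(** Finitely many formulas true at [U]-almost all [s n] hold together at some [s n], so saturation
    applies; conversely, [U] decides between a formula and its negation. *)
Lemma average_realized (m : nat) (s : nat -> 'I_m -> M) (U : set_system nat)
    (D : set M) : UltraFilter U -> small K D ->
  exists e : 'I_m -> M, forall phi, Defs.over D phi ->
    (psat phi e <-> U [set n | psat phi (s n)]).
Proof.
move=> UU sD.
pose p := [set phi : pformula M 'I_m | Defs.over D phi /\ U [set n | psat phi (s n)]].
have [|q qp finq|e eP] := M_saturated (p := p) sD.
- by move=> phi [].
- have : U [set n | forall phi, q phi -> psat phi (s n)].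
    by apply: filter_finite_forall => // phi /qp[].
  by move/filter_ex => -[n sn]; exists (s n).
exists e => phi phiD; split=> [pe|Up]; last exact: eP.
apply: contrapT => /(ultra_setC _ UU) Un.
by have /eP : p (pneg phi) by []; apply.
Qed.

(** * The Morley sequence generated by a coheir *)

Section Coheir.
Variables (m : nat) (s : nat -> 'I_m -> M) (U : set_system nat).
Hypothesis U_ultra : UltraFilter U.
Hypothesis U_nonprincipal : eventually `<=` U.
Variables (D0 : set M).
Hypothesis D0_countable : countable D0.
Hypothesis s_D0 : forall n, range (s n) `<=` D0.

(* [e i] realizes the average type of [s] along [U] over [D i]. *)
Variables (D : nat -> set M) (e : nat -> 'I_m -> M).
Hypothesis D_0 : D 0 = D0.
Hypothesis D_S : forall i, D i.+1 = D i `|` range (e i).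
Hypothesis e_average : forall i phi, Defs.over (D i) phi ->
  (psat phi (e i) <-> U [set n | psat phi (s n)]).

Lemma coheir_base_homo i j : (i <= j)%N -> D i `<=` D j.
Proof.
move=> /subnK <-; elim: (j - i)%N => //= k IH.
by rewrite addSn D_S; apply: subset_trans IH _ => x; left.
Qed.

Lemma coheir_base_countable i : countable (D i).
Proof.
elim: i => [|i IH]; first by rewrite D_0.
by rewrite D_S; apply: countableU => //; exact: countable_range.
Qed.

Lemma coheir_in_base i j b : (i < j)%N -> D j (e i b).
Proof. by move=> /coheir_base_homo; apply; rewrite D_S; right; exists b. Qed.

Lemma sub_coheir_base i : D0 `<=` D i.
Proof. by rewrite -D_0; apply: coheir_base_homo. Qed.

Lemma coheir_subst (X : finType) (phi : formula L X) (h : X -> 'I_m + M) i :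
    (forall x c, h x = inr c -> D i c) ->
  sat phi (fun x => join (e i) id (h x)) <->
  U [set n | sat phi (fun x => join (s n) id (h x))].
Proof.
move=> /(substitution phi) [psi psiD psiE].
by rewrite -psiE e_average//; apply: ultra_ext => n; exact: psiE.
Qed.

(** Induction on the length. The last term of an increasing tuple is an average over a base
    containing the earlier terms, so it may be replaced by [s n] for almost all [n]; as [s n] lies
    in [D0], a shorter tuple over [D0] remains. *)
Lemma coheir_indiscernible : indiscernible D0 e.
Proof.
move=> k i j hi hj; apply/eq_tpP => phi phiD.
elim: k i j hi hj phi phiD => [|k IH] i j hi hj phi phiD.
  rewrite (_ : (fun u : 'I_0 * 'I_m => e (i u.1) u.2) = fun u => e (j u.1) u.2)//.
  by apply/funext => -[[]].
(* [v c n] is the tuple with [s n] in place of its last term. *)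
pose v (c : 'I_k.+1 -> nat) n (u : 'I_k.+1 * 'I_m) :=
  if unlift ord_max u.1 is Some a then e (c (lift ord_max a)) u.2 else s n u.2.
have lt_max (a : 'I_k) : (lift ord_max a < (@ord_max k))%N by rewrite lift_max.
have topE (c : 'I_k.+1 -> nat) : {homo c : x y / (x < y)%N} ->
    psat phi (fun u => e (c u.1) u.2) <-> U [set n | psat phi (v c n)].
  move=> hc.
  pose h (x : ('I_k.+1 * 'I_m) + 'I_(nparams phi)) : 'I_m + M :=
    match x with
    | inl u => if unlift ord_max u.1 is Some a
               then inr (e (c (lift ord_max a)) u.2) else inl u.2
    | inr l => inr (params phi l)
    end.
  have hD x d : h x = inr d -> D (c ord_max) d.
    case: x => [[a b]|l] /=; last first.
      by move=> [<-]; apply: sub_coheir_base; apply: phiD; exists l.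
    case: (unlift ord_max a) => [a'|] // [<-].
    by apply: coheir_in_base; apply: hc; exact: lt_max.
  have := coheir_subst (matrix phi) hD.
  rewrite (_ : (fun x => _) = join (fun u => e (c u.1) u.2) (params phi)); last first.
    apply/funext => -[[a b]|l] //=.
    by case: unliftP => [a' ->|->].
  move=> E; apply: (iff_trans E); apply: ultra_ext => n /=.
  rewrite /psat (_ : (fun x => _) = join (v c n) (params phi))//.
  by apply/funext => -[[a b]|l] //=; rewrite /v /=; case: unliftP.
rewrite !topE//; apply: ultra_ext => n /=.
pose h (x : ('I_k.+1 * 'I_m) + 'I_(nparams phi)) : ('I_k * 'I_m) + M :=
  match x with
  | inl u => if unlift ord_max u.1 is Some a then inl (a, u.2) else inr (s n u.2)
  | inr l => inr (params phi l)
  end.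
have [|psi psiD psiE] := @substitution _ _ _ _ (matrix phi) h D0.
  case=> [[a b]|l] d /=; last by move=> [<-]; apply: phiD; exists l.
  by case: unliftP => // _ [<-]; apply: s_D0; exists b.
have psiv c : psat psi (fun u => e (c (lift ord_max u.1)) u.2) <-> psat phi (v c n).
  rewrite psiE /psat (_ : (fun x => _) = join (v c n) (params phi))//.
  by apply/funext => -[[a b]|l] //=; rewrite /v /=; case: unliftP.
rewrite -!psiv; apply: (IH (i \o lift ord_max) (j \o lift ord_max)) => // x y xy /=.
  by apply: hi; rewrite !lift_max.
by apply: hj; rewrite !lift_max.
Qed.

(** A dividing disjunct satisfied by the average would hold at some [s n]; since [s n] lies in [D0],
    indiscernibility over [D0] spreads it to all instances along the witness of dividing. *)
Lemma coheir_morley : morley D0 e.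
Proof.
split=> [|i phi impl [Psi [finPsi PsiD disj]]]; first exact: coheir_indiscernible.
(* The average is realized anew over a base with the parameters of the disjuncts, because [e i] is
   only known to be average over [D i]. *)
pose D' := D i `|` \bigcup_(psi in Psi) range (params psi) `|` range (params phi).
have cD' : countable D'.
  apply: countableU; last exact: countable_range.
  apply: countableU; first exact: coheir_base_countable.
  apply: bigcup_countable; first exact: finite_set_countable.
  by move=> psi _; exact: countable_range.
have [e' e'P] := average_realized s U_ultra (countable_small K_uncountable cD').
have /disj [psi Psi_psi] : psat phi e'.
  apply: impl => theta [thetaD theta_e].
  have thetaDi : Defs.over (D i) theta.
    apply: over_sub thetaD => c [|[j /= ij [b _ <-]]]; first exact: sub_coheir_base.
    exact: coheir_in_base.
  have thetaD' : Defs.over D' theta by apply: over_sub thetaDi => c Dc; left; left.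
  by rewrite (e'P _ thetaD') -(e_average thetaDi).
rewrite e'P; last by move=> c psic; left; right; exists psi.
move=> /filter_ex[n /= sn].
have [t [t0 tD nt]] := PsiD _ Psi_psi; apply: nt; exists (s n) => _ [l _ <-].
pose h (x : 'I_m + 'I_(nparams psi)) : ('I_1 * 'I_(nparams psi)) + M :=
  match x with inl a => inr (s n a) | inr b => inl (ord0, b) end.
have [|theta thetaD thetaE] := @substitution _ _ _ _ (matrix psi) h D0.
  by case=> [a|b] c //= [<-]; apply: s_D0; exists a.
have tE r : psat theta (fun u => t r u.2) <-> psat (PFormula (matrix psi) (t r)) (s n).
  rewrite thetaE /psat /= (_ : (fun x => _) = join (s n) (t r))//.
  by apply/funext => -[].
have homo1 r : {homo (fun _ : 'I_1 => r) : x y / (x < y)%N >-> (x < y)%N}.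
  by move=> x y; rewrite !ord1.
apply/tE; have /eq_tpP := tD 1 (fun=> l) (fun=> 0) (homo1 _) (homo1 _).
move=> /(_ theta thetaD) ->; apply/tE; rewrite t0.
by case: psi {Psi_psi t t0 tD h theta thetaD thetaE tE} sn.
Qed.

(** The terms [e (k-1), ..., e 0] are replaced from the left by terms of [s]. The term being
    replaced is an average over a base containing all other entries, whence the reversed order;
    nonprincipality makes the new index exceed the previous ones. Indiscernibility of [s] settles
    the fully replaced tuple. *)
Lemma coheir_rev (A : set M) (k : nat) (phi : formula L ('I_k * 'I_m)) :
    indiscernible A s ->
  sat phi (fun u => e (k.-1 - u.1) u.2) <-> sat phi (fun u => s u.1 u.2).
Proof.
move=> sA.
(* Entries before [j] have been replaced, with indices given by [n]; [r] counts those still to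
   go. *)
pose v (n : nat -> nat) j (u : 'I_k * 'I_m) :=
  if (u.1 < j)%N then s (n u.1) u.2 else e (k.-1 - u.1) u.2.
suff vE r j n : (j + r = k)%N -> (forall x y, (x < y < j)%N -> (n x < n y)%N) ->
    sat phi (v n j) <-> sat phi (fun u => s u.1 u.2).
  by rewrite -(vE k 0 id)// => x y; rewrite ltn0 andbF.
elim: r j n => [|r IH] j n.
  rewrite addn0 => -> n_homo.
  have {1}-> : v n k = fun u => s (n u.1) u.2.
    by apply/funext => -[a b]; rewrite /v /= ltn_ord.
  have [|theta thetaD thetaE] := @substitution L M _ ('I_k * 'I_m)%type phi inl A.
    by [].
  have := sA k (fun u => n u) (fun u => u); move/(_ _ _)/eq_tpP => H.
  rewrite -(thetaE (fun u => s (n u.1) u.2)) -(thetaE (fun u => s u.1 u.2)).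
  by apply: H => // x y xy; apply: n_homo; rewrite xy ltn_ord.
rewrite addnS => jrk n_homo.
have ltjk : (j < k)%N by rewrite -jrk ltnS leq_addr.
pose h (u : 'I_k * 'I_m) : 'I_m + M :=
  if val u.1 == j then inl u.2 else inr (v n j u).
have hD x d : h x = inr d -> D (k.-1 - j) d.
  rewrite /h /v; case: x => a b /=; case: ltngtP => // aj [<-].
    by apply: sub_coheir_base; apply: s_D0; exists b.
  apply: coheir_in_base; rewrite ltn_sub2l//.
  by rewrite (leq_trans aj)// -ltnS prednK ?ltn_ord// (leq_trans _ ltjk).
have := coheir_subst phi hD.
rewrite (_ : (fun x => join (e _) id (h x)) = v n j); last first.
  apply/funext => -[a b]; rewrite /h /v /=.
  by case: ltngtP => //= ->.
move=> ->.
have ev : U [set l | sat phi (fun x => join (s l) id (h x)) <->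
                     sat phi (fun u => s u.1 u.2)].
  (* Any [l] from this sum on exceeds every index [n i] with [i < j]. *)
  apply: U_nonprincipal; exists (\sum_(i < j) (n i).+1)%N => // l /= le_l.
  rewrite -(IH j.+1 (fun i => if i == j then l else n i))//; last first.
    move=> x y /andP[xy]; rewrite ltnS leq_eqVlt => /predU1P[yj|yj].
      subst y; rewrite eqxx (ltn_eqF xy); apply: leq_trans le_l.
      by rewrite (bigD1 (Ordinal xy))//= leq_addr.
    by rewrite !ltn_eqF// ?(ltn_trans xy yj)//; apply: n_homo; rewrite xy.
  rewrite (_ : (fun x => _) = v (fun i => if i == j then l else n i) j.+1)//.
  apply/funext => -[a b]; rewrite /h /v /= ltnS.
  by case: ltngtP => //.
split=> [Us|s_phi].
  by have [l [/= sl sE]] := filter_ex (filterI Us ev); apply/sE.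
by apply: filterS ev => l /= sE; apply/sE.
Qed.

(** For each [k], an automorphism taking the first [k] terms of [e], reversed, to those of [s]
    carries a common solution along [e] to one of the first [k] instances along [s]; compactness
    then makes all instances along [s] consistent. *)
Lemma coheir_inconsistent (A : set M) (n : nat) (psi : formula L ('I_n + 'I_m)) :
    indiscernible A s -> ~ consistent (instances psi s) ->
  ~ consistent (instances psi e).
Proof.
move=> sA; apply: contra_not => -[x xe].
apply: (M_saturated (countable_small K_uncountable D0_countable)).
  by move=> _ [i _ <-] /=; exact: s_D0.
move=> q qs finq.
have : \forall k \near eventually,
    forall phi, q phi -> exists2 i, (i < k)%N & phi = PFormula psi (s i).
  apply: filter_finite_forall => // phi /qs[i _ <-].
  by exists i.+1 => // k /= ik; exists i.
move=> /filter_ex[k kq].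
have [||g gA ge] := @homogeneity L M K ('I_k * 'I_m)%type
   (fun u => e (k.-1 - u.1) u.2) (fun u => s u.1 u.2) M_homogeneous.
- by apply: (countable_small K_uncountable); exact: countable_range.
- by move=> phi; exact: coheir_rev sA.
exists (g \o x) => phi /kq[i ik ->].
have -> : s i = g \o e (k.-1 - i).
  by apply/funext => b; rewrite /= (ge (Ordinal ik, b)).
by apply/(psat_pact (PFormula psi (e (k.-1 - i))) x gA); apply: xe; exists (k.-1 - i).
Qed.

End Coheir.

(* A dividing formula can be made Kim-dividing by enlarging the base with a
   witness [s] of dividing: the average of [s] along a nonprincipal
   ultrafilter is finitely satisfiable in the new base, hence generates a
   Morley sequence. *)
Lemma divides_kim_divides (q n : nat) (c : 'I_q -> M)
    (psi : pformula M 'I_n) (E : set M) :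
  divides (range c) psi -> countable E -> range c `<=` E ->
  exists g B, [/\ automorphism g, forall i, g (c i) = c i, E `<=` B,
    countable B & kim_divides B (pact g psi)].
Proof.
move=> [s [s0 sc ns]] cE subcE.
have [U [U_ultra U_ev]] := @ultraFilterLemma nat eventually _.
pose D0 := E `|` \bigcup_i range (s i).
have cD0 : countable D0.
  by apply: countableU => //; apply: bigcup_countable => // i _; exact: countable_range.
have sD0 i : range (s i) `<=` D0 by move=> x xs; right; exists i.
(* The value [s 0] at uncountable sets only makes [real] total; every [D i] is countable. *)
have /choice[real realP] (D : set M) : exists e, countable D -> forall phi,
    Defs.over D phi -> (psat phi e <-> U [set n | psat phi (s n)]).
  have [cD|ncD] := pselect (countable D); last by exists (s 0).
  have [e eP] := average_realized s U_ultra (countable_small K_uncountable cD).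
  by exists e.
pose D i := iter i (fun D => D `|` range (real D)) D0.
have cD i : countable (D i).
  by elim: i => //= i IH; apply: countableU => //; exact: countable_range.
pose e i := real (D i).
have D_S i : D i.+1 = D i `|` range (e i) by [].
have eP i phi : Defs.over (D i) phi -> (psat phi (e i) <-> U [set n | psat phi (s n)]).
  exact: realP.
(* All terms of [s] have the type of [s 0 = params psi] over [c], hence so does their average [e 0];
   an automorphism fixing [c] therefore moves [params psi] to [e 0]. *)
have typE phi : sat phi (join c (params psi)) <-> sat phi (join c (e 0)).
  pose h (x : 'I_q + 'I_(nparams psi)) : 'I_(nparams psi) + M :=
    match x with inl a => inr (c a) | inr b => inl b end.
  have hE z : (fun x => join z id (h x)) = join c z by apply/funext => -[].
  have [|theta thetaD thetaE] := @substitution _ _ _ _ phi h (range c).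
    by case=> // a d [<-]; exists a.
  rewrite -!hE -!thetaE eP; last first.
    by apply: over_sub thetaD; apply: subset_trans subcE _ => x; left.
  have sE l : psat theta (s l) <-> psat theta (params psi).
    rewrite -s0.
    have homo1 r : {homo (fun _ : 'I_1 => r) : x y / (x < y)%N >-> (x < y)%N}.
      by move=> x y; rewrite !ord1.
    have := sc 1 (fun=> l) (fun=> 0) (homo1 _) (homo1 _).
    move=> /eq_tpP/(_ (PFormula (formula_map (fun x => match x with
       inl a => inl (ord0, a) | inr b => inr b end) (matrix theta)) (params theta))).
    rewrite /psat /= !sat_map => /(_ thetaD).
    rewrite (_ : _ \o _ = join (s l) (params theta)); last by apply/funext => -[].
    by rewrite (_ : _ \o _ = join (s 0) (params theta)); last by apply/funext => -[].
  split=> [th|/filter_ex[l] /sE//].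
  by apply: filterS filterT => l _; apply/sE.
have [|g gA gE] := homogeneity M_homogeneous _ typE.
  apply: (countable_small K_uncountable).
  exact: countable_range.
exists g, D0; split=> //; first by move=> i; apply: (gE (inl i)).
  by move=> x; left.
exists e; split.
- apply/funext => i; exact: esym (gE (inr i)).
- exact: (coheir_morley U_ultra cD0 sD0 erefl D_S eP).
- exact: (coheir_inconsistent U_ultra U_ev cD0 sD0 erefl D_S eP sc).
Qed.

(** * Compactness for types, and supersimplicity against chains *)

(** The type together with the negations of [F] is inconsistent; [A0] collects the parameters of the
    formulas of the type in a finite inconsistent part. *)
Lemma tp_compact (n : nat) (a : 'I_n -> M) (A : set M)
    (F : set (pformula M 'I_n)) : small K A -> finite_set F ->
    (forall x, realizes (tp a A) x -> exists2 f, F f & psat f x) ->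
  exists A0, [/\ A0 `<=` A, finite_set A0 &
    forall x, realizes (tp a A0) x -> exists2 f, F f & psat f x].
Proof.
move=> sA finF cover.
pose q := tp a A `|` (@pneg L M 'I_n) @` F.
pose B := A `|` \bigcup_(f in F) range (params f).
have sB : small K B.
  apply: smallU_countable => //; apply: bigcup_countable.
    exact: finite_set_countable.
  by move=> f _; exact: countable_range.
have nq : ~ consistent q.
  move=> [x xq]; have [phi tpphi|f Ff] := cover x; first by apply: xq; left.
  by apply: (pnegE f x).1; apply: xq; right; exists f.
have [q0 [q0q finq0 nq0]] : exists q0, [/\ q0 `<=` q, finite_set q0 & ~ consistent q0].
  apply: contrapT => H; apply: nq; apply: (M_saturated sB).
    move=> phi [[phiA _]|[f Ff <-]]; first by apply: over_sub phiA => c; left.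
    by move=> c fc; right; exists f.
  by move=> q0 q0q finq0; apply: contrapT => nq0; apply: H; exists q0.
exists (\bigcup_(phi in q0 `&` tp a A) range (params phi)); split.
- by move=> c [phi [_ [phiA _]]]; exact: phiA.
- apply: bigcup_finite; first exact: finite_setIl.
  by move=> phi _; exact/finite_image/finite_finset.
- move=> x xA0; apply: contrapT => nF; apply: nq0; exists x => phi q0phi.
  case: (q0q _ q0phi) => [tpphi|[f Ff <-]]; last by move=> fx; apply: nF; exists f.
  by apply: xA0; split; [move=> c phic; exists phi|case: tpphi].
Qed.

Lemma tp_sub (X : Type) (a : X -> M) (A B : set M) : A `<=` B -> tp a A `<=` tp a B.
Proof. by move=> AB phi [phiA ?]; split=> //; exact: over_sub phiA. Qed.

Lemma supersimple_no_kim_forking_chain : supersimple K M ->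
  ~ (exists (n : nat) (d : 'I_n -> M) (A : nat -> set M),
      [/\ forall i, small K (A i),
          forall i, A i `<=` A i.+1 &
          forall i, type_kim_forks (A i) (tp d (A i.+1))]).
Proof.
move=> ss [n [d [A [sA AS kf]]]].
have homoA i j : (i <= j)%N -> A i `<=` A j.
  move=> /subnK <-; elim: (j - i)%N => //= k IH.
  by rewrite addSn; apply: subset_trans (AS _).
(* Each [A i.+1] is cut down to a finite [B i]: the union of the [A i] may fail to be small when [K]
   has countable cofinality, whereas that of the [B i] is countable. *)
have /choice[B BP] i : exists B, [/\ B `<=` A i.+1, finite_set B &
    exists2 phi : pformula M 'I_n, Defs.implies (tp d B) phi & forks (A i) phi].
  have [phi impl [Psi [finPsi PsiA disj]]] := kf i.
  have [|x /impl xphi|B [BA finB impB]] := @tp_compact _ d _ [set phi] (sA i.+1).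
  - exact: finite_set1.
  - by exists phi.
  - exists B; split=> //; exists phi => [x /impB[_ ->]//|].
    by exists Psi; split=> //; apply: subset_trans PsiA _; exact: kim_divides_divides.
have cB : countable (\bigcup_i B i).
  apply: bigcup_countable => // i _; apply: finite_set_countable.
  by case: (BP i).
have [A0 [A0B finA0 ind]] := ss n d _ (countable_small K_uncountable cB).
have : \forall k \near eventually, forall c, A0 c -> A k c.
  apply: filter_finite_forall => // c /A0B[i _ Bic].
  by exists i.+1 => // k /= /homoA; apply; case: (BP i) => + _ _; exact.
move=> /filter_ex[k A0k].
have [_ _ [phi impl fphi]] := BP k.
apply: (ind phi); last exact: forks_sub fphi.
move=> x xr; apply: impl => theta /(tp_sub (B := A0 `|` \bigcup_i B i)) H.
by apply: xr; apply: H => c Bc; right; exists k.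
Qed.

(** * The foundation rank of dividing *)

Section Rank.
Variable n : nat.
Local Notation pform := (pformula M 'I_n).

Definition child (phi' phi : pform) : Prop :=
  exists chi, [/\ divides (range (params phi)) chi, phi' = pand phi chi &
                  exists x, psat phi' x].

Lemma child_pact (g : M -> M) (phi' phi : pform) : automorphism g ->
  child phi' phi -> child (pact g phi') (pact g phi).
Proof.
move=> gA [chi [div -> [x xphi]]]; exists (pact g chi); split.
- by rewrite /= -image_comp; exact: divides_pact.
- exact: pact_pand.
- by exists (g \o x); apply/psat_pact.
Qed.

Lemma Acc_child_pact (g : M -> M) (phi : pform) : automorphism g ->
  Acc child phi -> Acc child (pact g phi).
Proof.
move=> gA accphi; elim: accphi => {}phi _ IH; apply: Acc_intro => psi chpsi.
have [h [hA hK gK]] := automorphism_inv gA.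
rewrite -(pactK psi gK); apply: IH => //.
by rewrite -(pactK phi hK); exact: child_pact.
Qed.

(** An inaccessible formula has an inaccessible child. An automorphism fixing the parameters of the
    parent makes the new conjunct [chi i] Kim-divide over a countable [B i] containing all earlier
    parameters; a common realization [d] of the [chi i] yields the chain. *)
Lemma no_kim_forking_chain_Acc_child :
  ~ (exists (d : 'I_n -> M) (A : nat -> set M),
      [/\ forall i, countable (A i),
          forall i, A i `<=` A i.+1 &
          forall i, type_kim_forks (A i) (tp d (A i.+1))]) ->
  forall phi : pform, Acc child phi.
Proof.
move=> nochain phi0; apply: contrapT => nacc0; apply: nochain.
pose good (st : pform * set M) := [/\ ~ Acc child st.1, countable st.2 &
  range (params st.1) `<=` st.2].
pose step (st st' : pform * set M) (B : set M) (chi : pform) :=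
  [/\ st.2 `<=` B /\ B `<=` st'.2, countable B, kim_divides B chi /\ Defs.over st'.2 chi,
      forall x, psat st'.1 x -> psat st.1 x /\ psat chi x & exists x, psat st'.1 x].
have stepP st : good st -> exists st' B chi, good st' /\ step st st' B chi.
  case: st => phi E [/= nacc cE phiE].
  have [_ [[chi [div -> [x sx]]] nacc']] :
      exists phi', child phi' phi /\ ~ Acc child phi'.
    apply: contrapT => H; apply: nacc; apply: Acc_intro => phi' ch.
    by apply: contrapT => nacc'; apply: H; exists phi'.
  have [g [B [gA gfix EB cB kd]]] := divides_kim_divides div cE phiE.
  have gphi : pact g phi = phi by apply: pact_id => c [i _ <-].
  have phiEq : pact g (pand phi chi) = pand phi (pact g chi).
    by rewrite pact_pand gphi.
  exists (pact g (pand phi chi), B `|` range (params (pact g (pand phi chi)))).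
  exists B, (pact g chi).
  split; split=> //.
  - move=> acc; apply: nacc'; have [h [hA hK gK]] := automorphism_inv gA.
    by rewrite -(pactK (pand phi chi) hK); exact: Acc_child_pact.
  - by apply: countableU => //; exact: countable_range.
  - by move=> c; right.
  - by split=> // c; left.
  - by split=> // c cc; right; rewrite [pact g _]phiEq; apply: params_pandr.
  - by rewrite phiEq => y /pandE.
  - by exists (g \o x); apply/psat_pact.
have good0 : good (phi0, range (params phi0)) by split=> //; exact: countable_range.
pose state := {st | good st}.
have /choice[f fP] (st : state) : exists r : state * set M * pform,
    step (sval st) (sval r.1.1) r.1.2 r.2.
  case: st => st /= /stepP[st' [B [chi [gst' ?]]]].
  by exists (exist _ st' gst', B, chi).
pose st i := iter i (fun s => (f s).1.1) (exist _ _ good0 : state).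
pose phi i := (sval (st i)).1.
pose E i := (sval (st i)).2.
pose B i := (f (st i)).1.2.
pose chi i := (f (st i)).2.
have stP i : step (phi i, E i) (phi i.+1, E i.+1) (B i) (chi i).
  by have := fP (st i); rewrite /phi /E /=; case: (sval _) => ? ?; case: (sval _).
have BS i : B i `<=` B i.+1.
  have [[_ BE] _ _ _ _] := stP i; have [[EB _] _ _ _ _] := stP i.+1.
  exact: subset_trans EB.
have phi_chi i k x : (i < k)%N -> psat (phi k) x -> psat (chi i) x.
  move=> /subnK <-; elim: (k - i.+1)%N => [|l IH].
    by rewrite add0n; have [_ _ _ H _] := stP i; move=> /H[].
  by rewrite addSn; have [_ _ _ H _] := stP (l + i.+1)%N; move=> /H[/IH].
have overchi i : Defs.over (B i.+1) (chi i).
  have [[EB _] _ _ _ _] := stP i.+1; have [_ _ [_ H] _ _] := stP i.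
  exact: over_sub H.
have cU : countable (\bigcup_i B i).
  by apply: bigcup_countable => // i _; case: (stP i).
(* A finite part mentions only [chi i] with [i < k]; these follow from [phi k.+1], which is
   consistent as the outcome of a step, while [phi 0] need not be. *)
have [||d dchi] := M_saturated (p := range chi) (countable_small K_uncountable cU).
- by move=> _ [i _ <-]; apply: over_sub (overchi i) => c Bc; exists i.+1.
- move=> q qchi finq.
  have : \forall k \near eventually,
      forall theta, q theta -> exists2 i, (i < k)%N & theta = chi i.
    apply: filter_finite_forall => // theta /qchi[i _ <-].
    by exists i.+1 => // k /= ik; exists i.
  move=> /filter_ex[k kq]; have [_ _ _ _ [x sx]] := stP k.
  by exists x => theta /kq[i ik ->]; apply: phi_chi sx; exact: ltnW.
- exists d, B; split=> // i; first by case: (stP i).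
  exists (chi i).
    by move=> x; apply; split; [exact: overchi|apply: dchi; exists i].
  exists [set chi i]; split; first exact: finite_set1.
    by move=> _ ->; case: (stP i) => _ _ [].
  by move=> x sx; exists (chi i).
Qed.

Lemma finite_range (T : Type) (A : set T) : finite_set A ->
  exists q (c : 'I_q -> T), A = range c.
Proof.
move=> /(@finite_seqP {classic T})[s ->].
exists (size s), (tnth (in_tuple s)); apply/predeqP => x /=; split.
  by move=> /(tnthP (in_tuple s))[i ->]; exists i.
by move=> [i _ <-]; exact: (mem_tnth i (in_tuple s)).
Qed.

(** [divides_kim_divides] moves [psi] until it divides over a set containing the parameters of [F];
    the inverse automorphism leaves [psi] in place and moves [F] instead. *)
Lemma divides_move (A0 : set M) (psi : pform) (F : set pform) :
    finite_set A0 -> divides A0 psi -> finite_set F ->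
  exists g, [/\ automorphism g, forall c, A0 c -> g c = c &
    forall f, F f -> divides (range (params (pact g f))) psi].
Proof.
move=> /finite_range[q [c ->]] div finF.
pose E := range c `|` \bigcup_(f in F) range (params f).
have [||g [B [gA gc EB _ kd]]] := divides_kim_divides (E := E) div.
- apply: countableU; first exact: countable_range.
  apply: bigcup_countable; first exact: finite_set_countable.
  by move=> f _; exact: countable_range.
- by move=> x; left.
have [h [hA hK gK]] := automorphism_inv gA.
exists h; split=> // [_ [i _ <-]|f Ff]; first by rewrite -{1}gc hK.
rewrite -(pactK psi hK).
have hsub : range (params (pact h f)) `<=` h @` B.
  move=> _ [i _ <-]; exists (params f i) => //.
  by apply: EB; right; exists f => //; exists i.
by apply: (divides_sub hsub); apply: divides_pact => //; exact: kim_divides_divides.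
Qed.

(** * Finite covers of a type that forks over every finite subset of its domain *)

Section Cover.
Variables (a : 'I_n -> M) (A : set M).
Hypothesis A_small : small K A.
Hypothesis A_dependent :
  forall A0, A0 `<=` A -> finite_set A0 -> ~ independent A0 a A.

Definition covers (S : set pform) : Prop :=
  exists F, [/\ finite_set F, F `<=` S &
    forall x, realizes (tp a A) x -> exists2 f, F f & psat f x].

Definition invariant_set (S : set pform) : Prop :=
  forall g phi, automorphism g -> S phi -> S (pact g phi).

Definition conjugates (phi : pform) : set pform :=
  [set psi | exists2 g, automorphism g & psi = pact g phi].

Lemma invariant_conjugates phi : invariant_set (conjugates phi).
Proof.
move=> g _ gA [h hA ->]; exists (g \o h) => //; exact: automorphism_comp.
Qed.

Lemma conjugates_refl phi : conjugates phi phi.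
Proof. by exists id; [exact: automorphism_id|rewrite pact_id]. Qed.

Lemma invariant_setU S S' :
  invariant_set S -> invariant_set S' -> invariant_set (S `|` S').
Proof. by move=> SI SI' g phi gA [?|?]; [left; apply: SI|right; apply: SI']. Qed.

Lemma covers_sub S S' : S `<=` S' -> covers S -> covers S'.
Proof. by move=> SS' [F [? FS ?]]; exists F; split=> //; exact: subset_trans SS'. Qed.

(* The formulas of a finite cover over a finite [A0] may be moved by
   automorphisms over [A0], independently for each disjunct [psi] of a forking
   formula, so that [psi] divides over their parameters. *)
Lemma covers_children S N : invariant_set S -> invariant_set N ->
  covers (S `|` N) -> covers (S `|` [set phi' | exists2 phi, N phi & child phi' phi]).
Proof.
move=> SI NI [F [finF FSN cover]].
(* Automorphisms over [A0] preserve [tp a A0] but perhaps not [tp a A], so [F] has to cover the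
   former. *)
have [A0 [A0A finA0 cover0]] := tp_compact A_small finF cover.
have [phi impl [Psi [finPsi PsiA0 disj]]] :
    exists2 phi : pformula M 'I_n, Defs.implies (tp a (A0 `|` A)) phi & forks A0 phi.
  apply: contrapT => H; apply: (A_dependent A0A finA0) => phi impl fphi.
  by apply: H; exists phi.
have /choice[g gP] psi : exists g, Psi psi ->
    [/\ automorphism g, forall c, A0 c -> g c = c &
    forall f, F f -> divides (range (params (pact g f))) psi].
  have [/PsiA0 div|nPsi] := pselect (Psi psi); last by exists id.
  by have [g ?] := divides_move finA0 div finF; exists g.
set S' := S `|` _.
exists (S' `&` \bigcup_(psi in Psi) (pact (g psi) @` F `|`
  (fun f => pand (pact (g psi) f) psi) @` F)); split.
- apply: finite_setIr; apply: bigcup_finite => // psi _.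
  by rewrite finite_setU; split; exact: finite_image.
- exact: subIsetl.
move=> x xA; have /disj[psi Ppsi psix] : psat phi x.
  by apply: impl; rewrite setUidr.
have [gA gA0 gdiv] := gP _ Ppsi; have [h [hA hK gK]] := automorphism_inv gA.
(* Since [h] fixes [A0], the tuple [h \o x] still realizes [tp a A0] and satisfies some [f]; hence
   [x] satisfies both the moved [f] and [psi], so their conjunction is consistent. *)
have [theta [thetaA0 thetaa]|f Ff fhx] := cover0 (h \o x).
  have <- : pact h theta = theta.
    by apply: (pact_fix thetaA0) => c A0c; rewrite -{1}(gA0 _ A0c) hK.
  by apply/psat_pact => //; apply: xA; split=> //; exact: over_sub thetaA0.
have fx : psat (pact (g psi) f) x.
  by rewrite (_ : x = g psi \o (h \o x)) ?psat_pact//; apply/funext => i /=.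
case: (FSN _ Ff) => [Sf|Nf].
  exists (pact (g psi) f) => //; split; first by left; exact: SI.
  by exists psi => //; left; exists f.
have fpsix : psat (pand (pact (g psi) f) psi) x by apply/pandE.
exists (pand (pact (g psi) f) psi) => //; split; last first.
  by exists psi => //; right; exists f.
right; exists (pact (g psi) f); first exact: NI.
by exists psi; split=> //; [exact: gdiv|exists x].
Qed.

Definition negligible (phi : pform) : Prop :=
  forall S, invariant_set S -> covers (S `|` conjugates phi) -> covers S.

Lemma negligible_pact (g : M -> M) phi : automorphism g ->
  negligible (pact g phi) -> negligible phi.
Proof.
move=> gA neg S SI cov; apply: neg => //; apply: covers_sub cov.
have [h [hA hK gK]] := automorphism_inv gA.
move=> psi [?|[k kA ->]]; [by left|right].
exists (k \o h); first exact: automorphism_comp.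
by rewrite -[in LHS](pactK phi hK).
Qed.

(** Only finitely many members of [N] occur in a cover. By induction on their number, the conjugates
    of one of them join [S], which stays invariant, while the others are dropped; then that one is
    dropped too. *)
Lemma covers_negligible S N : invariant_set S -> (forall phi, N phi -> negligible phi) ->
  covers (S `|` N) -> covers S.
Proof.
move=> SI Nneg [F [finF FSN cover]].
have : covers (S `|` (F `&` N)).
  exists F; split=> // phi Fphi; have [?|?] := FSN _ Fphi; first by left.
  by right.
have : forall phi, (F `&` N) phi -> negligible phi by move=> phi [_]; exact: Nneg.
have : finite_set (F `&` N) by exact: finite_setIl.
move: (F `&` N) => G finG; elim/finite_set_induction: finG S SI {FSN} => [|phi {}G IH] S SI.
  by rewrite setU0.
move=> Gneg cov; apply: (Gneg phi) => //; first by left.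
apply: IH.
- by apply: invariant_setU => //; exact: invariant_conjugates.
- by move=> psi Gpsi; apply: Gneg; right.
- apply: covers_sub cov => psi [?|[->|?]]; [by left; left|left; right|by right].
  exact: conjugates_refl.
Qed.

(** [covers_children] replaces conjugates of [phi] by their children; these are conjugates of
    children of [phi], hence negligible by well-founded induction. *)
Lemma Acc_negligible phi : Acc child phi -> negligible phi.
Proof.
elim=> {}phi _ IH S SI cov.
apply: (covers_negligible SI) (covers_children SI (@invariant_conjugates phi) cov).
move=> psi [_ [g gA ->] ch]; have [h [hA hK gK]] := automorphism_inv gA.
apply: (negligible_pact hA); apply: IH.
by rewrite -(pactK phi hK); exact: child_pact.
Qed.

(** The true formula covers every type. Were it negligible, the empty set would cover [tp a A],
    which [a] realizes. *)
Lemma not_Acc_child : ~ (forall phi : pform, Acc child phi).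
Proof.
move=> acc; have : covers set0.
  apply: (Acc_negligible (acc (ptop M 'I_n))); first by [].
  exists [set ptop M 'I_n]; split; first exact: finite_set1.
    by move=> _ ->; right; exact: conjugates_refl.
  by move=> x _; exists (ptop M 'I_n).
move=> [F [_ F0 cover]]; have [phi []|f /F0//] := cover a.
by [].
Qed.

End Cover.
End Rank.

(** * From the absence of countable chains to supersimplicity, and the equivalence *)

Lemma no_kim_forking_chain_supersimple :
  ~ (exists (n : nat) (d : 'I_n -> M) (A : nat -> set M),
      [/\ forall i, countable (A i),
          forall i, A i `<=` A i.+1 &
          forall i, type_kim_forks (A i) (tp d (A i.+1))]) ->
  supersimple K M.
Proof.
move=> nochain n a A sA; apply: contrapT => H.
apply: (@not_Acc_child n a A sA) => [A0 A0A finA0 ind|].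
  by apply: H; exists A0.
by apply: no_kim_forking_chain_Acc_child => -[d [B BP]]; apply: nochain; exists n, d, B.
Qed.

End Monster.

Theorem theorem3p7 (L : language) (T : theory L) (K : Type) (M : structure L)
    (T_complete : complete_theory T) (M_monster : monster_model T K M) :
  [<-> supersimple K M;
       ~ (exists (n : nat) (d : 'I_n -> M) (A : nat -> set M),
            [/\ forall i, small K (A i),
                forall i, A i `<=` A i.+1 &
                forall i, type_kim_forks (A i) (tp d (A i.+1))]);
       ~ (exists (n : nat) (d : 'I_n -> M) (A : nat -> set M),
            [/\ forall i, countable (A i),
                forall i, A i `<=` A i.+1 &
                forall i, type_kim_forks (A i) (tp d (A i.+1))])].
Proof.
case: M_monster => _ K_uncountable _ _ sat hom; tfae.
- exact: supersimple_no_kim_forking_chain.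
- apply: contra_not => -[n [d [A [cA AS kf]]]]; exists n, d, A; split=> // i.
  exact: (countable_small K_uncountable).
- exact: no_kim_forking_chain_supersimple.
Qed.
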